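(* Let $F=\frac1n\sum_{i=1}^nF_i$ be as in the context (each $F_i$ is $L_i$-Lipschitz and $(\mu_i,z^* )$-strongly monotone, $F(z^* )=0$), let $\xi^k$ be sampled uniformly, $\mathbb{P}[\xi^k=i]=\frac1n$ for $i\in\{1,\dots,n\}$, and assume $$\overline\mu=\frac1n\sum_{i:\mu_i\ge0}\mu_i+\frac4n\sum_{i:\mu_i<0}\mu_i>0 .$$ Let $L_{\max}=\max_{1\le i\le n}L_i$ and consider the biased S-SEG iterates with stepsizes $\gamma_{2,\xi^k}=\alpha\gamma_{1,\xi^k}$, $\alpha=\frac18$, $\gamma_{1,\xi^k}=\beta_k\gamma=\frac{\beta_k}{6L_{\max}}$, $0<\beta_k\le1$. Then for all $N>0$, for a suitable choice of $\{\beta_k\}_{k\ge 0}\subset(0,1]$ (depending on $N$), $$\mathbb{E}\big[\|z^N-z^*\|^2\big]=\mathcal O\left(\frac{L_{\max}R_0^2}{\overline\mu}\exp\left(-\frac{\overline\mu N}{L_{\max}}\right)+\frac{\sigma_{US*}^2}{\overline\mu^2N}+\frac{\zeta^2}{\overline\mu^2}\right),$$ where $R_0^2=\|z^0-z^*\|^2$ and $\sigma_{US*}^2=\frac1n\sum_{i=1}^n\|F_i(z^* )\|^2$.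
   Context: $\|\cdot\|$ is the Euclidean norm on $\mathbb{R}^d$. $F:\mathbb{R}^d\to\mathbb{R}^d$ is monotone and $z^*$ satisfies $F(z^* )=0$. $F_i$ is $L_i$-Lipschitz ($L_i>0$): $\|F_i(z_1)-F_i(z_2)\|\le L_i\|z_1-z_2\|$; $F_i$ is $(\mu_i,z^* )$-strongly monotone, with $\mu_i\in\mathbb{R}$ possibly negative: $\langle F_i(z)-F_i(z^* ),z-z^*\rangle\ge\mu_i\|z-z^*\|^2$ for all $z$. The bias $b:\mathbb{R}^d\to\mathbb{R}^d$ satisfies $\|b(z)\|^2\le\zeta^2$ for all $z$, $\zeta>0$. The biased S-SEG iterates from $z^0$ with independent samples $\xi^k$ are $$z^{k+\frac12}=z^k-\gamma_{1,\xi^k}\big(F_{\xi^k}(z^k)+b(z^k)\big),\qquad z^{k+1}=z^k-\gamma_{2,\xi^k}\big(F_{\xi^k}(z^{k+\frac12})+b(z^{k+\frac12})\big).$$ $\mathcal O(\cdot)$ hides numerical constants (including, in the paper's usage, numerical constants inside the exponent). *)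

(* Defs.v *)
From HB Require Import structures.
From mathcomp Require Export all_boot all_order all_algebra.
From mathcomp Require Export all_classical all_reals all_analysis.
Export Order.TTheory GRing.Theory Num.Theory.
Export numFieldNormedType.Exports.

Set Implicit Arguments.
Unset Strict Implicit.
Unset Printing Implicit Defensive.

#[export] Set Implicit Arguments.
#[export] Unset Strict Implicit.
#[export] Unset Printing Implicit Defensive.

Local Open Scope classical_set_scope.
Local Open Scope ring_scope.

Definition dotp (R : realType) (d : nat) (u v : 'rV[R]_d) : R :=
  \sum_(j < d) u 0 j * v 0 j.

(* The Euclidean norm; the library norm [`|u|] on ['rV[R]_d] is the sup norm. *)
Definition enorm (R : realType) (d : nat) (u : 'rV[R]_d) : R :=
  Num.sqrt (dotp u u).

Definition monotone_op (R : realType) (d : nat) (F : 'rV[R]_d -> 'rV[R]_d) :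
    Prop :=
  forall u v, 0 <= dotp (F u - F v) (u - v).

Definition lipschitz_op (R : realType) (d : nat) (l : R)
    (F : 'rV[R]_d -> 'rV[R]_d) : Prop :=
  forall u v, enorm (F u - F v) <= l * enorm (u - v).

(* (m, zs)-strong monotonicity; [m] may be negative. *)
Definition strongly_monotone_at (R : realType) (d : nat) (m : R)
    (zs : 'rV[R]_d) (F : 'rV[R]_d -> 'rV[R]_d) : Prop :=
  forall z, m * enorm (z - zs) ^+ 2 <= dotp (F z - F zs) (z - zs).

Definition mean_op (R : realType) (d n : nat)
    (F : 'I_n -> 'rV[R]_d -> 'rV[R]_d) (z : 'rV[R]_d) : 'rV[R]_d :=
  n%:R^-1 *: \sum_(i < n) F i z.

Definition mubar (R : realType) (n : nat) (mu : 'I_n -> R) : R :=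
  n%:R^-1 * (\sum_(i < n | 0 <= mu i) mu i)
  + 4 / n%:R * (\sum_(i < n | mu i < 0) mu i).

(* The default value 0 is harmless: it is only used for positive [L]. *)
Definition Lmax (R : realType) (n : nat) (L : 'I_n -> R) : R :=
  \big[Num.max/0]_(i < n) L i.

Definition sigma2_US (R : realType) (d n : nat)
    (F : 'I_n -> 'rV[R]_d -> 'rV[R]_d) (zs : 'rV[R]_d) : R :=
  n%:R^-1 * \sum_(i < n) enorm (F i zs) ^+ 2.

(* [sseg F b gamma1 gamma2 z0 xi k] is z^k along the sample path [xi]: both
   half-steps of iteration [k] use the same sample [xi k], and
   [gamma1 k i], [gamma2 k i] are the stepsizes used at iteration [k] when
   [xi k = i]. *)
Fixpoint sseg (R : realType) (d n : nat)
    (F : 'I_n -> 'rV[R]_d -> 'rV[R]_d) (b : 'rV[R]_d -> 'rV[R]_d)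
    (gamma1 gamma2 : nat -> 'I_n -> R) (z0 : 'rV[R]_d) (xi : nat -> 'I_n)
    (k : nat) : 'rV[R]_d :=
  if k is k'.+1 then
    let z := sseg F b gamma1 gamma2 z0 xi k' in
    let i := xi k' in
    let zhalf := z - gamma1 k' i *: (F i z + b z) in
    z - gamma2 k' i *: (F i zhalf + b zhalf)
  else z0.

(* ['I_n] carries no canonical sigma-algebra in the library; it is given the
   discrete one, so measurability and independence range over all subsets. *)
Definition measurable_samples (disp : measure_display)
    (T : measurableType disp) (n : nat) (xi : nat -> T -> 'I_n) : Prop :=
  forall k (A : set 'I_n), measurable (xi k @^-1` A).

Definition independent_samples (disp : measure_display)
    (T : measurableType disp) (R : realType) (P : probability T R) (n : nat)
    (xi : nat -> T -> 'I_n) : Prop :=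
  forall (J : seq nat) (A : nat -> set 'I_n), uniq J ->
    P (\bigcap_(k in [set` J]) (xi k @^-1` A k))
    = (\prod_(k <- J) P (xi k @^-1` A k))%E.

Definition uniform_samples (disp : measure_display)
    (T : measurableType disp) (R : realType) (P : probability T R) (n : nat)
    (xi : nat -> T -> 'I_n) : Prop :=
  forall k (i : 'I_n), P (xi k @^-1` [set i]) = (n%:R^-1)%:E.

(* Main.v *)
Require Import Defs.
From mathcomp Require Import ring lra zify measurable_realfun.
Local Open Scope classical_set_scope.
Local Open Scope ring_scope.

(** Write [m] for [mubar mu], [Lm] for [Lmax L] and [r k] for the expectation
    of the squared distance of z^k to [zs].

    One iteration.  Fix the sample [i] and let [y] be the distance vector of
    the half-step to [zs].  Strong monotonicity at [zs], used at the half-step,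
    bounds the progress from below by [mu i * |y|^2].  Going back from [y] to
    [x = z^k - zs] costs a factor 1/2 when [mu i] is nonnegative and a factor 2
    when it is negative; the ratio of these factors is the weight 4 in [m].
    The remaining quadratic terms are absorbed by the extra-gradient gain
    [<h, g> = (|h|^2 + |g|^2 - |h - g|^2) / 2], where [g] and [h] are the two
    evaluated (biased) operator values: a stepsize at most [1 / (6 Lm)] makes
    [h - g] small compared with [g], up to the bias.  This is [seg_descent].
    Averaging over [i] kills the linear term [<F_i zs, x>], because the mean
    operator vanishes at [zs], and with gamma the larger stepsize gives
    ([sseg_step_mean_bound])
      [r (k+1) <= (1 - 3/32 gamma m) r k + gamma^2 sigma^2
                  + 7/6 gamma zeta^2 / m].

    Stepsizes.  Run at the largest stepsize during the first half of the [N]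
    iterations, so that the initial error decays geometrically, and decrease
    the stepsize like [1 / s] in the second half, where [s] grows by one at
    each iteration; this brings the variance term down to order [1 / N]
    without a logarithm.  Both phases obey the single recursion of
    [decreasing_step_bound].  The bias contributes a fixed point of the
    recursion, of order [zeta^2 / m^2], whatever the stepsizes are.

    Expectation.  z^k only depends on the first [k] samples, which take
    finitely many values, all equally likely by independence; the expectation
    is therefore a finite average over tuples ([expectation_history]), and the
    tower property becomes the splitting off of the last sample
    ([uniform_meanS]). *)

(** * Euclidean geometry *)

Lemma dotpC (R : realType) d (u v : 'rV[R]_d) : dotp u v = dotp v u.
Proof. by apply: eq_bigr => j _; rewrite mulrC. Qed.

Lemma dotpDl (R : realType) d (u v w : 'rV[R]_d) :
  dotp (u + v) w = dotp u w + dotp v w.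
Proof. by rewrite -big_split; apply: eq_bigr => j _; rewrite mxE mulrDl. Qed.

Lemma dotpZl (R : realType) d a (u w : 'rV[R]_d) :
  dotp (a *: u) w = a * dotp u w.
Proof. by rewrite mulr_sumr; apply: eq_bigr => j _; rewrite mxE mulrA. Qed.

Lemma dotpNl (R : realType) d (u w : 'rV[R]_d) : dotp (- u) w = - dotp u w.
Proof. by rewrite -scaleN1r dotpZl mulN1r. Qed.

Lemma dotpDr (R : realType) d (u v w : 'rV[R]_d) :
  dotp w (u + v) = dotp w u + dotp w v.
Proof. by rewrite dotpC dotpDl !(dotpC w). Qed.

Lemma dotpZr (R : realType) d a (u w : 'rV[R]_d) :
  dotp w (a *: u) = a * dotp w u.
Proof. by rewrite dotpC dotpZl dotpC. Qed.

Lemma dotpNr (R : realType) d (u w : 'rV[R]_d) : dotp w (- u) = - dotp w u.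
Proof. by rewrite dotpC dotpNl dotpC. Qed.

Definition dotpE := (dotpDl, dotpDr, dotpNl, dotpNr, dotpZl, dotpZr).

Lemma dotp_ge0 (R : realType) d (u : 'rV[R]_d) : 0 <= dotp u u.
Proof. by apply: sumr_ge0 => j _; rewrite -expr2 sqr_ge0. Qed.

Lemma enorm_sqr (R : realType) d (u : 'rV[R]_d) : enorm u ^+ 2 = dotp u u.
Proof. by rewrite sqr_sqrtr ?dotp_ge0. Qed.

Lemma enorm_sqrZ (R : realType) d a (u : 'rV[R]_d) :
  enorm (a *: u) ^+ 2 = a ^+ 2 * enorm u ^+ 2.
Proof. by rewrite !enorm_sqr !dotpE expr2 mulrA. Qed.

Lemma enorm_sqrD_le (R : realType) d (u v : 'rV[R]_d) :
  enorm (u + v) ^+ 2 <= 2 * enorm u ^+ 2 + 2 * enorm v ^+ 2.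
Proof.
by have := dotp_ge0 (u - v); rewrite !enorm_sqr !dotpE (dotpC v u); lra.
Qed.

(** Young's inequality, with the absolute value so that it bounds the scalar
    product from both sides; it replaces Cauchy-Schwarz everywhere below. *)
Lemma young (R : realType) d (a : R) (u v : 'rV[R]_d) : 0 < a ->
  2 * `|dotp u v| <= a * enorm u ^+ 2 + a^-1 * enorm v ^+ 2.
Proof.
move=> a0; rewrite !enorm_sqr.
have key s : s ^+ 2 = 1 ->
    2 * (s * dotp u v) <= a * dotp u u + a^-1 * dotp v v.
  move=> s1; have := dotp_ge0 (a *: u - s *: v).
  (* the square is [a] times the difference of the two sides *)
  suff -> : dotp (a *: u - s *: v) (a *: u - s *: v) =
    a * (a * dotp u u + a^-1 * dotp v v - 2 * (s * dotp u v)).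
    by rewrite pmulr_rge0// subr_ge0.
  have ssv : s * (s * dotp v v) = dotp v v by rewrite mulrA -expr2 s1 mul1r.
  rewrite [RHS]mulrBr [in RHS]mulrDr [a * (a^-1 * _)]mulrA divff ?gt_eqF//.
  by rewrite -[in RHS]ssv !dotpE (dotpC v u); ring.
case: (ler0P (dotp u v)) => _.
  by have := key (-1); rewrite sqrrN expr1n mulN1r; exact.
by have := key 1; rewrite expr1n mul1r; exact.
Qed.

(** The lower bound makes it harmless that the strong monotonicity constant of
    an operator may be arbitrarily negative: the Lipschitz constant limits how
    negative its effect can be. *)
Lemma lipschitz_dotp_le (R : realType) d (l : R) (G : 'rV[R]_d -> 'rV[R]_d)
    u v :
  0 < l -> lipschitz_op l G ->
  `|dotp (G u - G v) (u - v)| <= l * enorm (u - v) ^+ 2.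
Proof.
move=> l0 /(_ u v) lipG.
have lipG2 : enorm (G u - G v) ^+ 2 <= l ^+ 2 * enorm (u - v) ^+ 2.
  by rewrite -exprMn lerXn2r// nnegrE ?mulr_ge0 ?sqrtr_ge0// ltW.
(* Young with this weight makes both terms of size [l * enorm (u - v) ^+ 2] *)
have := @young R d (l^-1) (G u - G v) (u - v).
rewrite invr_gt0 invrK => /(_ l0) Y.
have : l^-1 * enorm (G u - G v) ^+ 2 <= l * enorm (u - v) ^+ 2.
  by rewrite ler_pdivrMl// mulrA -expr2.
move: Y; lra.
Qed.

(** * One iteration *)

(** The constants can be compared only at a point different from [zs], whence
    the positive dimension. *)
Lemma strongly_monotone_le_lipschitz (R : realType) (d : nat) (l m : R)
    (zs : 'rV[R]_d) (G : 'rV[R]_d -> 'rV[R]_d) :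
  (0 < d)%N -> 0 < l -> lipschitz_op l G -> strongly_monotone_at m zs G ->
  m <= l.
Proof.
move=> d0 l0 lipG smG; pose v : 'rV[R]_d := const_mx 1.
have v0 : 0 < enorm v ^+ 2.
  rewrite enorm_sqr /dotp (eq_bigr (fun=> 1)) => [|j _]; last first.
    by rewrite !mxE mulr1.
  by rewrite sumr_const card_ord ltr0n.
rewrite -(ler_pM2r v0); have -> : v = zs + v - zs by rewrite addrC addKr.
apply: le_trans (smG _) _; apply: le_trans (ler_norm _) _.
exact: lipschitz_dotp_le.
Qed.

(** The energy estimate of one iteration for one sample.  The stepsize is
    absorbed into all the data: [x] is [z - zs], while [g], [h], [f], [b] are
    the larger stepsize times the operator value used in the half-step, the
    one used in the full step, [F_i zs], and the bias at the half-step.  Then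
    [x - g] is the half-step minus [zs] and [h - f - b] is the stepsize times
    [F_i zhalf - F_i zs].  The parameter [e] (the stepsize times the average
    monotonicity constant) says how much of the contraction is given up to pay
    for the bias. *)
Lemma seg_descent (R : realType) d (x g h f b : 'rV[R]_d) (m e zeta2 : R) :
  0 < e <= 6^-1 -> m <= 6^-1 -> enorm b ^+ 2 <= zeta2 ->
  m * enorm (x - g) ^+ 2 <= dotp (h - f - b) (x - g) ->
  `|dotp (h - f - b) (x - g)| <= 6^-1 * enorm (x - g) ^+ 2 ->
  enorm (h - g) ^+ 2 <= 18^-1 * enorm g ^+ 2 + 8 * zeta2 ->
  enorm (x - 8^-1 *: h) ^+ 2 <=
    (1 - 4^-1 * ((if 0 <= m then m else 4 * m) / 2 - e / 8)) * enorm x ^+ 2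
    - 4^-1 * dotp f x + (enorm f ^+ 2 + zeta2 + zeta2 / e).
Proof.
(* The coefficient of [enorm g ^+ 2] decides which constants are affordable:
   1/2 from [<h, g>], minus 1/36 (from [h - g]), 1/16 (from [<f, g>]),
   1/3 (from [m]) and 1/48 (from the bias), leaves 1/18. *)
case/andP=> e0 e6 m6 bz sm; rewrite ler_norml => /andP[lo _] hg.
have Yf := @young R d 8^-1 g f; rewrite invrK in Yf.
have {Yf} fg : dotp f g <= 16^-1 * enorm g ^+ 2 + 4 * enorm f ^+ 2.
  have := ler_norm (dotp f g); rewrite dotpC; lra.
have {bz} by_ : - dotp b (x - g) <=
    e / 16 * enorm (x - g) ^+ 2 + 4 * (zeta2 / e).
  have := @young R d (e / 8) (x - g) b; rewrite divr_gt0// => /(_ isT).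
  rewrite invf_div mulrAC -mulrA => Y.
  have : enorm b ^+ 2 / e <= zeta2 / e by rewrite ler_pM2r ?invr_gt0.
  have := ler_norm (- dotp b (x - g)); rewrite normrN dotpC.
  lra.
have Yx : enorm (x - g) ^+ 2 <= 2 * enorm x ^+ 2 + 2 * enorm g ^+ 2.
  have := dotp_ge0 (x + g); rewrite !enorm_sqr !dotpE (dotpC g x); lra.
have Xy : enorm x ^+ 2 <= 2 * enorm (x - g) ^+ 2 + 2 * enorm g ^+ 2.
  have := dotp_ge0 (x - 2 *: g); rewrite !enorm_sqr !dotpE (dotpC g x); lra.
have eY : e * enorm (x - g) ^+ 2 <= 2 * e * enorm x ^+ 2 + 3^-1 * enorm g ^+ 2.
  have : e * enorm g ^+ 2 <= 6^-1 * enorm g ^+ 2 by rewrite ler_wpM2r ?sqr_ge0.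
  have : e * enorm (x - g) ^+ 2 <= e * (2 * enorm x ^+ 2 + 2 * enorm g ^+ 2).
    by rewrite ler_pM2l.
  lra.
have uy : (if 0 <= m then m else 4 * m) / 2 * enorm x ^+ 2 - 3^-1 * enorm g ^+ 2
    <= dotp (h - f - b) (x - g).
  have G0 := sqr_ge0 (enorm g); have X0 := sqr_ge0 (enorm x).
  have [m0|m0] := leP 0 m.
    have : m * enorm x ^+ 2 <= m * (2 * enorm (x - g) ^+ 2 + 2 * enorm g ^+ 2).
      by rewrite ler_wpM2l.
    have : m * enorm g ^+ 2 <= 6^-1 * enorm g ^+ 2 by rewrite ler_wpM2r.
    lra.
  (* below -1/6, the Lipschitz lower bound [lo] is better than [sm] *)
  have [m6'|m6'] := leP (- 6^-1) m.
    have : m * (2 * enorm x ^+ 2 + 2 * enorm g ^+ 2) <= m * enorm (x - g) ^+ 2.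
      by rewrite ler_nM2l.
    have : - 6^-1 * enorm g ^+ 2 <= m * enorm g ^+ 2 by rewrite ler_wpM2r.
    lra.
  have : m * enorm x ^+ 2 <= - 6^-1 * enorm x ^+ 2.
    by rewrite ler_wpM2r// ltW.
  lra.
have H0 := sqr_ge0 (enorm h); have G0 := sqr_ge0 (enorm g).
move: hg fg by_ uy H0 G0 eY; rewrite !enorm_sqr !dotpE.
rewrite ?(dotpC g h) ?(dotpC x h) ?(dotpC b g) ?(dotpC b h) ?(dotpC x g).
rewrite ?(dotpC f g) ?(dotpC f h) ?(dotpC f x) ?(dotpC b x) ?(dotpC b f).
set w := (X in X / 2).
lra.
Qed.

Definition sseg_step (R : realType) (d n : nat)
    (F : 'I_n -> 'rV[R]_d -> 'rV[R]_d)
    (b : 'rV[R]_d -> 'rV[R]_d) (g1 g2 : R) (i : 'I_n) (z : 'rV[R]_d) :=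
  let zhalf := z - g1 *: (F i z + b z) in
  z - g2 *: (F i zhalf + b zhalf).

Lemma mubarE (R : realType) n (mu : 'I_n -> R) :
  mubar mu = n%:R^-1 * \sum_(i < n) (if 0 <= mu i then mu i else 4 * mu i).
Proof.
rewrite /mubar -mulrA mulrCA -mulrDr; congr (_ * _).
rewrite mulr_sumr big_mkcond [X in _ + X]big_mkcond -big_split /=.
by apply: eq_bigr => i _; case: leP; rewrite ?addr0 ?add0r.
Qed.

Lemma mubar_gt0_size (R : realType) n (mu : 'I_n -> R) :
  0 < mubar mu -> (0 < n)%N.
Proof. by case: n mu => // mu; rewrite mubarE invr0 mul0r ltxx. Qed.

Lemma sigma2_US_ge0 (R : realType) d n (F : 'I_n -> 'rV[R]_d -> 'rV[R]_d) zs :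
  0 <= sigma2_US F zs.
Proof.
by rewrite mulr_ge0 ?invr_ge0// sumr_ge0// => i _; rewrite sqr_ge0.
Qed.

Lemma mubar_le_Lmax (R : realType) n (L mu : 'I_n -> R) :
  (forall i, 0 <= L i) -> (forall i, mu i <= L i) -> mubar mu <= Lmax L.
Proof.
move=> L0 muL; case: n => [|n] in L mu L0 muL *.
  by rewrite mubarE /Lmax !big_ord0 mulr0.
rewrite mubarE ler_pdivrMl ?ltr0n// mulr_natl.
have -> : Lmax L *+ n.+1 = \sum_(i < n.+1) Lmax L.
  by rewrite sumr_const card_ord.
apply: ler_sum => i _; apply: le_trans (le_bigmax _ L i).
have := muL i; have := L0 i; case: (leP 0 (mu i)); lra.
Qed.

(** The constants [l] and [e] are free, so that they can be taken as [Lmax] and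
    [mubar], which do not depend on the sample. *)
Lemma sseg_step_bound (R : realType) d n (F : 'I_n -> 'rV[R]_d -> 'rV[R]_d)
    (b : 'rV[R]_d -> 'rV[R]_d) zs z (i : 'I_n) (l m e g zeta : R) :
  0 < l -> lipschitz_op l (F i) -> strongly_monotone_at m zs (F i) ->
  (forall z, enorm (b z) ^+ 2 <= zeta ^+ 2) ->
  m <= l -> 0 < e <= l -> 0 < g <= (6 * l)^-1 ->
  enorm (sseg_step F b g (8^-1 * g) i z - zs) ^+ 2 <=
    (1 - 4^-1 * (g * (if 0 <= m then m else 4 * m) / 2 - g * e / 8))
      * enorm (z - zs) ^+ 2
    - 4^-1 * (g * dotp (F i zs) (z - zs))
    + (g ^+ 2 * enorm (F i zs) ^+ 2 + g ^+ 2 * zeta ^+ 2 + g * zeta ^+ 2 / e).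
Proof.
move=> l0 lipF smF bz ml /andP[e0 el] /andP[g0 gl].
have g6 : g * l <= 6^-1 by rewrite -ler_pdivlMr// -invfM.
rewrite /sseg_step; set zh := z - g *: (F i z + b z).
have gm a : a <= l -> g * a <= 6^-1.
  by move=> al; rewrite (le_trans _ g6)// ler_pM2l.
have yE : z - zs - g *: (F i z + b z) = zh - zs by rewrite addrAC.
have uE : g *: (F i zh + b zh) - g *: F i zs - g *: b zh =
    g *: (F i zh - F i zs).
  by rewrite !scalerDr scalerN addrAC addrK.
have ge0 : 0 < g * e by rewrite mulr_gt0.
have ifE : (if 0 <= g * m then g * m else 4 * (g * m)) =
           g * (if 0 <= m then m else 4 * m).
  by rewrite pmulr_rge0//; case: ifP => // _; rewrite mulrCA.
have -> : z - (8^-1 * g) *: (F i zh + b zh) - zs =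
    z - zs - 8^-1 *: (g *: (F i zh + b zh)) by rewrite addrAC scalerA.
have := @seg_descent R d (z - zs) (g *: (F i z + b z)) (g *: (F i zh + b zh))
  (g *: F i zs) (g *: b zh) (g * m) (g * e) (g ^+ 2 * zeta ^+ 2).
rewrite yE uE ifE !enorm_sqrZ !dotpZl ge0 !gm//.
have -> : g ^+ 2 * zeta ^+ 2 / (g * e) = g * zeta ^+ 2 / e.
  by field; rewrite !gt_eqF.
apply=> //.
- by rewrite ler_pM2l ?exprn_gt0.
- by rewrite -mulrA ler_pM2l// smF.
- rewrite normrM gtr0_norm//.
  apply: (@le_trans _ _ (g * (l * enorm (zh - zs) ^+ 2))).
    by rewrite ler_pM2l// lipschitz_dotp_le.
  by rewrite mulrA ler_wpM2r ?sqr_ge0.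
have -> : g *: (F i zh + b zh) - g *: (F i z + b z) =
    g *: (F i zh - F i z) + g *: (b zh - b z).
  by rewrite !scalerDr !scalerN opprD addrACA.
have lipF2 : g ^+ 2 * enorm (F i zh - F i z) ^+ 2 <=
    36^-1 * (g ^+ 2 * enorm (F i z + b z) ^+ 2).
  have zhz : enorm (zh - z) ^+ 2 = g ^+ 2 * enorm (F i z + b z) ^+ 2.
    by rewrite /zh addrAC subrr sub0r -scaleNr enorm_sqrZ sqrrN.
  rewrite -zhz; have := lipF zh z; set q := enorm (zh - z) => lq.
  have q0 : 0 <= q by rewrite sqrtr_ge0.
  have -> : 36^-1 * q ^+ 2 = (6^-1 * q) ^+ 2 by rewrite exprMn; field.
  have le1 : g * enorm (F i zh - F i z) <= 6^-1 * q.
    apply: (@le_trans _ _ (g * (l * q))); first by rewrite ler_pM2l.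
    by rewrite mulrA ler_wpM2r.
  rewrite -exprMn lerXn2r// nnegrE mulr_ge0 ?sqrtr_ge0//; exact: ltW.
have b1 : g ^+ 2 * enorm (b zh) ^+ 2 <= g ^+ 2 * zeta ^+ 2.
  by rewrite ler_pM2l ?exprn_gt0.
have b2 : g ^+ 2 * enorm (b z) ^+ 2 <= g ^+ 2 * zeta ^+ 2.
  by rewrite ler_pM2l ?exprn_gt0.
have := enorm_sqrD_le (g *: (F i zh - F i z)) (g *: (b zh - b z)).
have := enorm_sqrD_le (g *: b zh) (g *: - b z); rewrite -scalerDr !enorm_sqrZ.
have -> : enorm (- b z) = enorm (b z) by rewrite /enorm !dotpE opprK.
lra.
Qed.

(** The contraction 1/8 obtained from half of [mubar] loses the 1/32 spent on
    the bias in [seg_descent], whence 3/32. *)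
Lemma sseg_step_mean_bound (R : realType) d n (F : 'I_n -> 'rV[R]_d -> 'rV[R]_d)
    (L mu : 'I_n -> R) (b : 'rV[R]_d -> 'rV[R]_d) zs z (g zeta : R) :
  mean_op F zs = 0 -> (forall i, 0 < L i) ->
  (forall i, lipschitz_op (L i) (F i)) ->
  (forall i, strongly_monotone_at (mu i) zs (F i)) ->
  (forall i, mu i <= L i) -> 0 < mubar mu ->
  (forall z, enorm (b z) ^+ 2 <= zeta ^+ 2) ->
  0 < g <= (6 * Lmax L)^-1 ->
  n%:R^-1 * \sum_(i < n) enorm (sseg_step F b g (8^-1 * g) i z - zs) ^+ 2 <=
    (1 - 3 / 32 * (g * mubar mu)) * enorm (z - zs) ^+ 2
    + (g ^+ 2 * sigma2_US F zs + 7 / 6 * (g * zeta ^+ 2 / mubar mu)).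
Proof.
move=> Fzs L0 lipF smF muL mb0 bz /andP[g0 gL].
have n0 := mubar_gt0_size mb0.
have nR : n%:R != 0 :> R by rewrite pnatr_eq0 -lt0n.
have LmL i : L i <= Lmax L by exact: le_bigmax.
have mbL : mubar mu <= Lmax L by apply: mubar_le_Lmax => // i; exact: ltW.
have Lm0 : 0 < Lmax L by exact: lt_le_trans mbL.
have mean_cst (a : R) : n%:R^-1 * (\sum_(i < n) a) = a.
  by rewrite sumr_const card_ord -[a *+ n]mulr_natl mulrA mulVf ?mul1r.
have step i : enorm (sseg_step F b g (8^-1 * g) i z - zs) ^+ 2 <= _ :=
  @sseg_step_bound R d n F b zs z i (Lmax L) (mu i) (mubar mu) g zeta
    Lm0 (fun u v => le_trans (lipF i u v)
           (ler_wpM2r (sqrtr_ge0 _) (LmL i))) (smF i) bz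
    (le_trans (muL i) (LmL i)) (introT andP (conj mb0 mbL))
    (introT andP (conj g0 gL)).
set e := mubar mu in mb0 mbL step *.
set X := enorm (z - zs) ^+ 2.
have S0 : \sum_(i < n) dotp (F i zs) (z - zs) = 0.
  have -> : \sum_(i < n) dotp (F i zs) (z - zs) =
      dotp (\sum_(i < n) F i zs) (z - zs).
    elim/big_ind2: _ => [|u1 x1 u2 x2 -> ->|//]; last by rewrite dotpDl.
    by rewrite -[X in dotp X _](scale0r 0) dotpZl mul0r.
  move/eqP: Fzs; rewrite scaler_eq0 invr_eq0 (negbTE nR)/= => /eqP->.
  by rewrite -[X in dotp X _](scale0r 0) dotpZl mul0r.
pose w i := if 0 <= mu i then mu i else 4 * mu i.
(* [step], regrouped into a part independent of [i], the sum over [mu] that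
   rebuilds [mubar], the linear part of zero mean, and the variance *)
apply: (@le_trans _ _ (n%:R^-1 * \sum_(i < n)
   ((1 + g * e / 32) * X + (g ^+ 2 * zeta ^+ 2 + g * zeta ^+ 2 / e)
    + ((- (8^-1 * g * X)) * w i + (- (4^-1 * g)) * dotp (F i zs) (z - zs)
    + g ^+ 2 * enorm (F i zs) ^+ 2)))).
  rewrite ler_wpM2l ?invr_ge0//; apply: ler_sum => i _.
  apply: le_trans (step i) _; rewrite -/(w i) -/X le_eqVlt; apply/orP; left.
  by apply/eqP; field; rewrite gt_eqF.
rewrite big_split/= mulrDr mean_cst !big_split /= -!mulr_sumr S0 mulr0 addr0.
have -> (p q u v : R) : n%:R^-1 * (p * u + q * v) =
    p * (n%:R^-1 * u) + q * (n%:R^-1 * v) by ring.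
rewrite -/(sigma2_US F zs) -[n%:R^-1 * \sum_i w i](mubarE mu) -/e.
have : g ^+ 2 * zeta ^+ 2 <= 6^-1 * (g * zeta ^+ 2 / e).
  have -> : g ^+ 2 * zeta ^+ 2 = g * e * (g * zeta ^+ 2 / e).
    by field; rewrite gt_eqF.
  rewrite ler_wpM2r ?(divr_ge0 (mulr_ge0 (ltW g0) (sqr_ge0 _)) (ltW mb0))//.
  rewrite -ler_pdivlMr// (le_trans gL)// invfM ler_pM2l ?invr_gt0//.
  by rewrite lef_pV2.
lra.
Qed.

(** * Stepsize schedule *)

(** The recursion for the stepsize proportional to [2 / s k]: constant up to
    [k0] (truncated subtraction makes [s k = kappa] there), then decreasing.
    The bound [A / s] is preserved because
    [(1 - 2 / s) * A / s + A / s^2 <= A / (s + 1)], and [U] because it is the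
    fixed point of the part of the recursion in which it occurs. *)
Lemma decreasing_step_bound (R : realType) (r : nat -> R) (kappa A U : R)
    (k0 : nat) :
  2 <= kappa -> 0 <= A -> 0 <= U -> 0 <= r 0%N ->
  let s k := kappa + (k - k0)%:R in
  (forall k, r k.+1 <= (1 - 2 / s k) * r k + (A / s k ^+ 2 + 2 / s k * U)) ->
  forall k, r k <= (1 - 2 / kappa) ^+ minn k k0 * r 0%N + A / s k + U.
Proof.
move=> k2 A0 U0 r0 s rS.
have s2 k : 2 <= s k by rewrite (le_trans k2)// lerDl.
have s0 k : 0 < s k by exact: lt_le_trans (s2 k).
have q0 : 0 <= 1 - 2 / kappa.
  have kappa0 : 0 < kappa by exact: lt_le_trans k2.
  by rewrite subr_ge0 ler_pdivrMr ?mul1r.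
have t0 k : 0 <= 2 / s k <= 1.
  by rewrite divr_ge0 ?(ltW (s0 k))//= ler_pdivrMr ?mul1r.
have invS k : (s k)^-1 - (s k)^-1 ^+ 2 <= (s k.+1)^-1.
  have sS : s k.+1 <= s k + 1.
    by rewrite /s -addrA lerD2l natr1 ler_nat; lia.
  have s10 : 0 < s k + 1 by apply: addr_gt0.
  apply: (@le_trans _ _ (s k + 1)^-1); last first.
    by rewrite lef_pV2 ?posrE ?s0.
  rewrite -[leRHS]mul1r ler_pdivlMr//.
  have -> : ((s k)^-1 - (s k)^-1 ^+ 2) * (s k + 1) = 1 - (s k)^-1 ^+ 2.
    by field; rewrite gt_eqF.
  by rewrite gerBl sqr_ge0.
have qS k : (1 - 2 / s k) * (1 - 2 / kappa) ^+ minn k k0 <=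
    (1 - 2 / kappa) ^+ minn k.+1 k0.
  have [kk0|k0k] := boolP (k < k0)%N.
    have -> : minn k.+1 k0 = (minn k k0).+1 by lia.
    have -> : s k = kappa by rewrite /s (eqP (ltnW kk0)) addr0.
    by rewrite exprS.
  have -> : minn k.+1 k0 = minn k k0 by lia.
  by rewrite ler_piMl ?exprn_ge0// gerBl; case/andP: (t0 k).
elim=> [|k IHk].
  by rewrite min0n expr0 mul1r -addrA lerDl addr_ge0// divr_ge0// ltW.
apply: le_trans (rS k) _; case/andP: (t0 k) => t0' t1.
have step1 : (1 - 2 / s k) * r k <= (1 - 2 / s k) *
    ((1 - 2 / kappa) ^+ minn k k0 * r 0%N + A / s k + U).
  by rewrite ler_wpM2l ?subr_ge0.
have step2 := ler_wpM2r r0 (qS k).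
have step3 := ler_wpM2l A0 (invS k).
move: step1 step2 step3; rewrite expr2 -exprVn.
set q := _ ^+ minn k k0; set q' := _ ^+ minn k.+1 k0.
set i := (s k)^-1; set i' := (s k.+1)^-1; lra.
Qed.

(** * Expectation of a function of uniform samples *)

(** Latest value first, so that a new sample is a [cons]. *)
Fixpoint history (I : Type) (p : nat -> I) (k : nat) : seq I :=
  if k is k'.+1 then p k' :: history p k' else [::].

Lemma size_history (I : Type) (p : nat -> I) k : size (history p k) = k.
Proof. by elim: k => //= k ->. Qed.

Lemma nth_history (I : Type) x0 (p : nat -> I) k j :
  (j < k)%N -> nth x0 (history p k) (k.-1 - j) = p j.
Proof.
elim: k => //= k IHk; rewrite ltnS leq_eqVlt => /orP[/eqP->|jk].
  by rewrite subnn.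
have -> : (k - j = (k.-1 - j).+1)%N by lia.
by rewrite /= IHk.
Qed.

Lemma history_eqP (I : Type) x0 (p : nat -> I) k (t : seq I) : size t = k ->
  history p k = t <-> forall j, (j < k)%N -> p j = nth x0 t (k.-1 - j).
Proof.
move=> tk; split=> [<- j jk|pt]; first by rewrite nth_history.
apply: (@eq_from_nth _ x0) => [|j]; rewrite size_history ?tk// => jk.
have <- : (k.-1 - (k.-1 - j) = j)%N by lia.
rewrite nth_history ?pt//; lia.
Qed.

Definition uniform_mean (R : realType) (n k : nat) (phi : seq 'I_n -> R) : R :=
  n%:R^-1 ^+ k * \sum_(t : k.-tuple 'I_n) phi t.

Lemma uniform_mean0 (R : realType) n (phi : seq 'I_n -> R) :
  uniform_mean 0 phi = phi [::].
Proof.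
rewrite /uniform_mean expr0 mul1r (big_pred1 [tuple])// => t.
by symmetry; apply/eqP; exact: tuple0.
Qed.

(** The tower property: average first over the last sample. *)
Lemma uniform_meanS (R : realType) n k (phi : seq 'I_n -> R) :
  uniform_mean k.+1 phi =
  uniform_mean k (fun s => n%:R^-1 * \sum_(i < n) phi (i :: s)).
Proof.
rewrite /uniform_mean -mulr_sumr mulrA -exprSr; congr (_ * _).
rewrite exchange_big pair_big/=.
rewrite (reindex (fun p : 'I_n * k.-tuple 'I_n => [tuple of p.1 :: p.2]))//=.
exists (fun t => (thead t, [tuple of behead t])) => [[i s] _|t _] /=.
  by congr pair; apply: val_inj.
by rewrite [RHS]tuple_eta; apply: val_inj.
Qed.

Lemma uniform_mean_affine (R : realType) n k (a c : R) (phi : seq 'I_n -> R) :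
  (0 < n)%N ->
  uniform_mean k (fun s => a * phi s + c) = a * uniform_mean k phi + c.
Proof.
move=> n0; rewrite /uniform_mean big_split/= -mulr_sumr sumr_const card_tuple.
rewrite card_ord mulrDr mulrCA; congr (_ + _).
rewrite -[c *+ _]mulr_natl natrX mulrA -exprMn.
by rewrite mulVf ?expr1n ?mul1r// pnatr_eq0 -lt0n.
Qed.

Lemma uniform_mean_le (R : realType) n k (phi psi : seq 'I_n -> R) :
  (forall s, size s = k -> phi s <= psi s) ->
  uniform_mean k phi <= uniform_mean k psi.
Proof.
move=> le_phi_psi; rewrite ler_wpM2l ?exprn_ge0 ?invr_ge0//.
by apply: ler_sum => t _; rewrite le_phi_psi ?size_tuple.
Qed.

(** The event that the first [k] samples are prescribed is an intersection of
    one event per sample, to which independence applies. *)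
Lemma probability_history (disp : measure_display) (T : measurableType disp)
    (R : realType) (P : probability T R) n (xi : nat -> T -> 'I_n) k
    (t : k.-tuple 'I_n) :
  (0 < n)%N -> measurable_samples xi -> independent_samples P xi ->
  uniform_samples P xi ->
  measurable [set w | history (xi^~ w) k = t] /\
  P [set w | history (xi^~ w) k = t] = (n%:R^-1 ^+ k)%:E.
Proof.
move=> n0 mxi ixi uxi; pose i0 := Ordinal n0.
pose A j : set 'I_n := [set nth i0 t (k.-1 - j)].
have -> : [set w | history (xi^~ w) k = t] =
    \bigcap_(j in [set` iota 0 k]) (xi j @^-1` A j).
  apply/seteqP; split=> w /=; rewrite (history_eqP i0 _ (size_tuple t)) => h j.
    by rewrite /= mem_iota => /h.
  by move=> jk; apply: h; rewrite /= mem_iota.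
split; first by apply: bigcap_measurableType => j _; apply: mxi.
rewrite ixi ?iota_uniq// (eq_bigr (fun=> (n%:R^-1)%:E)) => [|j _]; last first.
  exact: uxi.
by rewrite prodEFin big_const_seq count_predT size_iota iter_mulr_1.
Qed.

(** A function of the history is a combination of indicators of the events of
    [probability_history], all of the same probability. *)
Lemma expectation_history (disp : measure_display) (T : measurableType disp)
    (R : realType) (P : probability T R) n (xi : nat -> T -> 'I_n) k
    (phi : seq 'I_n -> R) :
  (0 < n)%N -> measurable_samples xi -> independent_samples P xi ->
  uniform_samples P xi -> (forall s, 0 <= phi s) ->
  ('E_P[fun w => phi (history (xi^~ w) k)] = (uniform_mean k phi)%:E)%E.
Proof.
move=> n0 mxi ixi uxi phi0; rewrite unlock.
pose A (t : k.-tuple 'I_n) := [set w | history (xi^~ w) k = t].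
have PA k' (t : k'.-tuple _) := probability_history t n0 mxi ixi uxi.
transitivity
  (\int[P]_w \sum_(t : k.-tuple 'I_n) ((phi t)%:E * (\1_(A t) w)%:E))%E.
  apply: eq_integral => w _.
  have hk : size (history (xi^~ w) k) == k by rewrite size_history.
  rewrite (bigD1 (Tuple hk))//= big1 => [|t /eqP tw].
    by rewrite indicE mem_set// mule1 adde0.
  rewrite indicE memNset ?mule0//= => E; apply: tw; exact: val_inj.
rewrite ge0_integral_sum//=; first last.
- by move=> t w _; rewrite -EFinM lee_fin mulr_ge0.
- move=> t; apply: measurable_funeM; apply/measurable_EFinP.
  by apply: measurable_indic; case: (PA _ t).
rewrite /uniform_mean mulr_sumr -sumEFin; apply: eq_bigr => t _.
have [mA EA] := PA _ t.
rewrite ge0_integralZl_EFin//; last first.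
  by apply/measurable_EFinP/measurable_indic.
by rewrite integral_indic// setIT [X in (_ * X)%E]EA -EFinM mulrC.
Qed.

(** * The rate *)

(** The iterate as a function of the history of samples, in the order of
    [history]; the length of the history is the iteration number. *)
Fixpoint sseg_past (R : realType) (d n : nat)
    (F : 'I_n -> 'rV[R]_d -> 'rV[R]_d) (b : 'rV[R]_d -> 'rV[R]_d)
    (gamma1 gamma2 : nat -> 'I_n -> R) (z0 : 'rV[R]_d) (s : seq 'I_n) :=
  if s is i :: s' then
    sseg_step F b (gamma1 (size s') i) (gamma2 (size s') i) i
      (sseg_past F b gamma1 gamma2 z0 s')
  else z0.

Lemma sseg_history (R : realType) (d n : nat)
    (F : 'I_n -> 'rV[R]_d -> 'rV[R]_d) (b : 'rV[R]_d -> 'rV[R]_d)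
    (gamma1 gamma2 : nat -> 'I_n -> R) (z0 : 'rV[R]_d) (p : nat -> 'I_n) k :
  sseg F b gamma1 gamma2 z0 p k =
  sseg_past F b gamma1 gamma2 z0 (history p k).
Proof. by elim: k => //= k ->; rewrite size_history. Qed.

(** With [kappa = 128 Lm / m], the choice [beta_j = kappa / s j] turns the
    contraction [3/32 gamma m] of [sseg_step_mean_bound] into exactly
    [2 / s j]. *)
Lemma mean_sqr_dist_bound (R : realType) (d n : nat)
    (F : 'I_n -> 'rV[R]_d -> 'rV[R]_d) (L mu : 'I_n -> R)
    (zs : 'rV[R]_d) (b : 'rV[R]_d -> 'rV[R]_d) (zeta : R) (z0 : 'rV[R]_d)
    (k0 : nat) :
  mean_op F zs = 0 -> (forall i, 0 < L i) ->
  (forall i, lipschitz_op (L i) (F i)) ->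
  (forall i, strongly_monotone_at (mu i) zs (F i)) ->
  (forall i, mu i <= L i) -> 0 < mubar mu ->
  (forall z, enorm (b z) ^+ 2 <= zeta ^+ 2) ->
  let kappa := 128 * Lmax L / mubar mu in
  let s j := kappa + (j - k0)%:R in
  let gamma1 := fun j (_ : 'I_n) => kappa / s j / (6 * Lmax L) in
  let gamma2 := fun j i => 8^-1 * gamma1 j i in
  forall k, uniform_mean k
    (fun t => enorm (sseg_past F b gamma1 gamma2 z0 t - zs) ^+ 2) <=
  (1 - 2 / kappa) ^+ minn k k0 * enorm (z0 - zs) ^+ 2
  + 4096 / 9 * (sigma2_US F zs / mubar mu ^+ 2) / s k
  + 112 / 9 * (zeta ^+ 2 / mubar mu ^+ 2).
Proof.
move=> Fzs L0 lipF smF muL mb0 bz kappa s gamma1 gamma2.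
have mbL : mubar mu <= Lmax L by apply: mubar_le_Lmax => // i; exact: ltW.
have Lm0 : 0 < Lmax L by exact: lt_le_trans mbL.
have kappa2 : 2 <= kappa by rewrite ler_pdivlMr//; lra.
have kappa0 : 0 < kappa by exact: lt_le_trans kappa2.
have s0 j : 0 < s j by rewrite ltr_wpDr.
have n0 := mubar_gt0_size mb0.
pose D t := enorm (sseg_past F b gamma1 gamma2 z0 t - zs) ^+ 2.
pose r j := uniform_mean j D.
have sigma0 := sigma2_US_ge0 F zs.
have r0E : r 0%N = enorm (z0 - zs) ^+ 2 by rewrite /r uniform_mean0.
rewrite -r0E; apply: (@decreasing_step_bound R r).
- exact: kappa2.
- apply: mulr_ge0; first by apply: divr_ge0; exact: ler0n.
  by apply: divr_ge0; [exact: sigma0 | exact: sqr_ge0].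
- by apply: mulr_ge0; apply: divr_ge0; rewrite ?ler0n ?sqr_ge0.
- by rewrite r0E sqr_ge0.
move=> j; rewrite -/(s j).
rewrite /r uniform_meanS -uniform_mean_affine//; apply: uniform_mean_le => t tj.
rewrite /D /= /gamma2 /gamma1 tj.
set g := kappa / s j / (6 * Lmax L).
have gE : g = 64 / 3 / mubar mu / s j.
  by rewrite /g /kappa; field; rewrite !gt_eqF//.
have g0 : 0 < g by rewrite !divr_gt0// mulr_gt0.
have := @sseg_step_mean_bound R d n F L mu b zs
  (sseg_past F b gamma1 gamma2 z0 t) g zeta Fzs L0 lipF smF muL mb0 bz.
rewrite g0/= => /(_ _)/le_trans; apply.
  rewrite /g -[leRHS]mul1r ler_pM2r ?invr_gt0 ?mulr_gt0//.
  by rewrite ler_pdivrMr// mul1r lerDl.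
rewrite le_eqVlt; apply/orP; left; apply/eqP; rewrite gE.
by field; rewrite !gt_eqF.
Qed.

Theorem corollary1 (R : realType) :
  exists C c : R, 0 < C /\ 0 < c /\
  forall (d n : nat) (F : 'I_n -> 'rV[R]_d -> 'rV[R]_d) (L mu : 'I_n -> R)
    (zs : 'rV[R]_d) (b : 'rV[R]_d -> 'rV[R]_d) (zeta : R) (z0 : 'rV[R]_d),
    monotone_op (mean_op F) ->
    mean_op F zs = 0 ->
    (forall i, 0 < L i) ->
    (forall i, lipschitz_op (L i) (F i)) ->
    (forall i, strongly_monotone_at (mu i) zs (F i)) ->
    0 < mubar mu ->
    0 < zeta ->
    (forall z, enorm (b z) ^+ 2 <= zeta ^+ 2) ->
  forall N : nat, (0 < N)%N ->
  exists beta : nat -> R,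
    (forall k, 0 < beta k <= 1) /\
    forall (disp : measure_display) (T : measurableType disp)
      (P : probability T R) (xi : nat -> T -> 'I_n),
      measurable_samples xi ->
      independent_samples P xi ->
      uniform_samples P xi ->
      let gamma1 := fun (k : nat) (_ : 'I_n) => beta k / (6 * Lmax L) in
      let gamma2 := fun (k : nat) (i : 'I_n) => 8^-1 * gamma1 k i in
      ('E_P[fun w => (enorm (sseg F b gamma1 gamma2 z0 (fun k => xi k w) N
                             - zs) ^+ 2)%R]
       <= (C * (Lmax L * enorm (z0 - zs) ^+ 2 / mubar mu
                  * expR (- (c * (mubar mu * N%:R / Lmax L)))
                + sigma2_US F zs / (mubar mu ^+ 2 * N%:R)
                + zeta ^+ 2 / mubar mu ^+ 2))%:E)%E.
Proof.
(* 1000 exceeds 2 * 4096 / 9 and 112 / 9; at least N / 2 contractions by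
   [1 - 2 / kappa = 1 - m / (64 Lm)] give the 1/128 *)
exists 1000, 128^-1; split; first by rewrite ltr0n.
split; first by rewrite invr_gt0 ltr0n.
move=> d n F L mu zs b zeta z0 _ Fzs L0 lipF smF mb0 zeta0 bz N N0.
have n0 := mubar_gt0_size mb0.
have Lm0 : 0 < Lmax L by apply: lt_le_trans (le_bigmax _ L (Ordinal n0)).
have NR : 0 < N%:R :> R by rewrite ltr0n.
have sigma0 := sigma2_US_ge0 F zs.
set X := enorm (z0 - zs) ^+ 2; have X0 : 0 <= X by exact: sqr_ge0.
set E := expR _; have E0 : 0 < E by exact: expR_gt0.
set Z := zeta ^+ 2 / _; have Z0 : 0 <= Z by rewrite divr_ge0// sqr_ge0.
have S0 : 0 <= sigma2_US F zs / (mubar mu ^+ 2 * N%:R).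
  by rewrite divr_ge0// mulr_ge0 ?sqr_ge0 ?ltW.
have T0 : 0 <= Lmax L * X / mubar mu * E
  by rewrite (mulr_ge0 _ (ltW E0))// (divr_ge0 (mulr_ge0 (ltW Lm0) X0))// ltW.
(* In dimension 0 the [mu i] are not bounded by the [L i], but the iterates
   are all equal to [zs]. *)
have [d0|d0] := posnP d.
  exists (fun=> 1); split=> [_|disp T P xi _ _ _].
    by rewrite ltr01 lexx.
  have zero (v : 'rV[R]_d) : enorm v ^+ 2 = 0.
    by rewrite enorm_sqr /dotp big1// => j _; have := ltn_ord j; rewrite {2}d0.
  cbv zeta; rewrite [X in ('E_P[X])%E](_ : _ = cst 0); last first.
    by apply/funext => w; exact: zero.
  rewrite expectation_cst lee_fin; lra.
have muL i : mu i <= L i.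
  exact: strongly_monotone_le_lipschitz (lipF i) (smF i).
have mbL : mubar mu <= Lmax L by apply: mubar_le_Lmax => // i; exact: ltW.
pose kappa := 128 * Lmax L / mubar mu; pose k0 := (N - N./2)%N.
have kappa128 : 128 <= kappa by rewrite ler_pdivlMr// ler_pM2l.
have kappa0 : 0 < kappa by apply: lt_le_trans kappa128.
exists (fun k => kappa / (kappa + (k - k0)%:R)); split=> [k|].
  rewrite divr_gt0 ?ltr_wpDr//= ler_pdivrMr ?ltr_wpDr//.
  by rewrite mul1r lerDl.
move=> disp T P xi mxi ixi uxi; cbv zeta.
under [X in 'E_P[X]%E]eq_fun do rewrite sseg_history.
rewrite (@expectation_history _ T R P n xi N
  (fun t => enorm (sseg_past F b _ _ z0 t - zs) ^+ 2))//; last first.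
  by move=> t; exact: sqr_ge0.
rewrite lee_fin.
apply: le_trans (@mean_sqr_dist_bound R d n F L mu zs b zeta z0 k0
  Fzs L0 lipF smF muL mb0 bz N) _.
rewrite -/kappa -/X -/Z.
have -> : minn N k0 = k0 by apply/minn_idPr/leq_subr.
have decay : (1 - 2 / kappa) ^+ k0 <= E.
  apply: (@le_trans _ _ (expR (- (2 / kappa)) ^+ k0)).
    rewrite lerXn2r ?nnegrE ?expR_ge0 ?expR_ge1Dx//.
    by rewrite subr_ge0 ler_pdivrMr// mul1r; lra.
  rewrite -expRM_natl ler_expR mulrN lerN2 /kappa.
  have -> : 128^-1 * (mubar mu * N%:R / Lmax L) =
      N%:R * (mubar mu / Lmax L / 128).
    by field; rewrite gt_eqF.
  have -> : k0%:R * (2 / (128 * Lmax L / mubar mu)) =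
      (2 * k0)%:R * (mubar mu / Lmax L / 128).
    by rewrite (natrM _ 2 k0); field; rewrite !gt_eqF.
  rewrite ler_pM2r ?divr_gt0// ler_nat /k0; clear; lia.
have X1 : X <= Lmax L * X / mubar mu.
  by rewrite ler_pdivlMr// mulrC ler_wpM2r.
have t1 : (1 - 2 / kappa) ^+ k0 * X <= Lmax L * X / mubar mu * E.
  apply: (@le_trans _ _ (E * X)); first by rewrite ler_wpM2r.
  by rewrite mulrC ler_wpM2r// ltW.
have t2 : sigma2_US F zs / mubar mu ^+ 2 / (kappa + (N - k0)%:R) <=
    2 * (sigma2_US F zs / (mubar mu ^+ 2 * N%:R)).
  have -> : 2 * (sigma2_US F zs / (mubar mu ^+ 2 * N%:R)) =
      sigma2_US F zs / mubar mu ^+ 2 * (2 / N%:R).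
    by field; rewrite !gt_eqF.
  apply: ler_wpM2l; first by rewrite divr_ge0 ?sqr_ge0.
  rewrite ler_pdivlMr// mulrC ler_pdivrMr ?ltr_wpDr//.
  (* the missing 1 when [N] is odd is covered by [kappa] *)
  have : (N <= 2 * (N - k0) + 1)%N by rewrite /k0; clear; lia.
  rewrite -(ler_nat R) natrD (natrM _ 2); lra.
lra.
Qed.
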